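(* Let $n\in\mathbb{N}$ and let $\mathcal{M}$ be a first-order reduct of the ordered random $n$-uniform hypergraph $\mathcal{OH}_n$ which is not interdefinable with $\mathcal{OH}_n$, not interdefinable with the pure infinite set, and not interdefinable with the dense linear order $(\mathrm{OH}_n,<)$. Then $\operatorname{age}(\mathcal{M})$ is not a Ramsey class.
   Context: An ordered $n$-uniform hypergraph is a structure $(A,<,R)$ with $<$ a linear order and $R$ an $n$-ary relation such that $R(a_1,\dots,a_n)$ implies the $a_i$ are distinct and $R$ is invariant under permutations of its arguments. $\mathcal{OH}_n$ is the Fraïssé limit of the class of finite ordered $n$-uniform hypergraphs. A first-order reduct of a structure is a structure on the same domain all of whose relations and functions are $\emptyset$-definable in it; two structures on the same domain are interdefinable if each is a reduct of the other. A Ramsey class is a class of finite structures with the hereditary property, the joint embedding property and the Ramsey property: for all $A\subseteq B$ in the class there is $C$ in the class such that for every 2-colouring of embeddings of $A$ into $C$ some embedding $B'$ of $B$ into $C$ has all embeddings of $A$ with image in $B'$ of one colour.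
   Formalization: The theorem is stated for n ≥ 2: for n = 0 the Fraïssé limit does not exist, and for n = 1 the claim is false (reorder (Q,<,P) by putting P before its complement; the resulting reduct is a dense linear order with Ramsey age, not interdefinable with any of the three excluded structures). *)

(* Defs.v *)
From mathcomp Require Import all_boot all_fingroup.
From mathcomp Require Import boolp classical_sets functions cardinality.

Set Implicit Arguments.
Unset Strict Implicit.
Unset Printing Implicit Defensive.

Local Open Scope classical_set_scope.

Record language := Language {
  funsym : Type;
  relsym : Type;
  funar : funsym -> nat;
  relar : relsym -> nat
}.

(* A structure with domain [D]; the domain is a parameter, so that "two
   structures on the same domain" is a matter of typing.  Empty domains are
   allowed. *)
Record structure (L : language) (D : Type) := Structure {
  fint : forall f : funsym L, ('I_(funar f) -> D) -> D;
  rint : forall r : relsym L, ('I_(relar r) -> D) -> Prop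
}.

Inductive term (L : language) (k : nat) :=
| Var of 'I_k
| App (f : funsym L) of 'I_(funar f) -> term L k.

Inductive formula (L : language) : nat -> Type :=
| Bot k : formula L k
| Eq k : term L k -> term L k -> formula L k
| Rel k (r : relsym L) : ('I_(relar r) -> term L k) -> formula L k
| Imp k : formula L k -> formula L k -> formula L k
| All k : formula L k.+1 -> formula L k.

(* The tuple [(v 0, ..., v (k-1), d)]: [All] binds the last variable. *)
Definition vsnoc (D : Type) k (v : 'I_k -> D) (d : D) : 'I_k.+1 -> D :=
  fun i => oapp v d (unlift ord_max i).

Section Semantics.
Variables (L : language) (D : Type) (M : structure L D).

Fixpoint eval k (v : 'I_k -> D) (t : term L k) : D :=
  match t with
  | Var i => v i
  | App f ts => fint M (fun i => eval v (ts i))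
  end.

Fixpoint sat k (phi : formula L k) : ('I_k -> D) -> Prop :=
  match phi in formula _ k return ('I_k -> D) -> Prop with
  | Bot _ => fun=> False
  | Eq _ t u => fun v => eval v t = eval v u
  | Rel _ r ts => fun v => rint M (fun i => eval v (ts i))
  | Imp _ phi psi => fun v => sat phi v -> sat psi v
  | All _ phi => fun v => forall d : D, sat phi (vsnoc v d)
  end.

Definition definable k (X : ('I_k -> D) -> Prop) : Prop :=
  exists phi : formula L k, forall v, sat phi v <-> X v.

End Semantics.

(* The value of the function is the last coordinate. *)
Definition graph (D : Type) k (F : ('I_k -> D) -> D) : ('I_k.+1 -> D) -> Prop :=
  fun v => F (fun i => v (lift ord_max i)) = v ord_max.

Definition fo_reduct (L1 L2 : language) (D : Type)
    (M : structure L1 D) (N : structure L2 D) : Prop :=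
  (forall r : relsym L1, definable N (@rint L1 D M r)) /\
  (forall f : funsym L1, definable N (graph (@fint L1 D M f))).

Definition interdefinable (L1 L2 : language) (D : Type)
    (M : structure L1 D) (N : structure L2 D) : Prop :=
  fo_reduct M N /\ fo_reduct N M.

Definition is_embedding (L : language) (D E : Type)
    (A : structure L D) (B : structure L E) (h : D -> E) : Prop :=
  [/\ injective h,
      forall (f : funsym L) v, h (fint A (f := f) v) = fint B (h \o v)
    & forall (r : relsym L) v, rint A (r := r) v <-> rint B (h \o v)].

Definition embeds (L : language) (D E : Type)
    (A : structure L D) (B : structure L E) : Prop :=
  exists h : D -> E, is_embedding A B h.

Definition is_automorphism (L : language) (D : Type) (M : structure L D)
    (h : D -> D) : Prop :=
  is_embedding M M h /\ bijective h.

Definition finitely_generated (L : language) (D : Type) (A : structure L D) :=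
  exists2 S : set D, finite_set S &
    forall P : set D, S `<=` P ->
      (forall (f : funsym L) v, (forall i, P (v i)) -> P (fint A (f := f) v)) ->
      P = setT.

Definition struct_class (L : language) :=
  forall D : Type, structure L D -> Prop.

Definition age (L : language) (D : Type) (M : structure L D) : struct_class L :=
  fun _ A => finitely_generated A /\ embeds A M.

(* An isomorphism between finitely generated substructures of [M] is given as
   a pair of embeddings into [M] of one finitely generated structure. *)
Definition homogeneous (L : language) (D : Type) (M : structure L D) : Prop :=
  forall (E : Type) (A : structure L E) (h1 h2 : E -> D),
    finitely_generated A -> is_embedding A M h1 -> is_embedding A M h2 ->
    exists2 s : D -> D, is_automorphism M s & s \o h1 = h2.

Definition fraisse_limit (L : language) (K : struct_class L)
    (D : Type) (M : structure L D) : Prop :=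
  [/\ countable [set: D],
      homogeneous M
    & forall (E : Type) (A : structure L E), age M A <-> K E A].

Section Ramsey.
Variables (L : language) (K : struct_class L).

Definition all_finite : Prop :=
  forall (D : Type) (A : structure L D), K A -> finite_set [set: D].

Definition hereditary : Prop :=
  forall (D E : Type) (A : structure L D) (B : structure L E),
    K B -> embeds A B -> K A.

Definition joint_embedding : Prop :=
  forall (D E : Type) (A : structure L D) (B : structure L E),
    K A -> K B ->
    exists (F : Type) (C : structure L F), [/\ K C, embeds A C & embeds B C].

(* The colouring [chi] is defined on all maps, but only its values on
   embeddings of [A] into [C] are used. *)
Definition ramsey_property : Prop :=
  forall (D E : Type) (A : structure L D) (B : structure L E),
    K A -> K B -> embeds A B ->
    exists (F : Type) (C : structure L F), K C /\
      forall chi : (D -> F) -> bool,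
        exists2 g : E -> F, is_embedding B C g &
          exists c : bool, forall h : D -> F,
            is_embedding A C h -> range h `<=` range g -> chi h = c.

Definition ramsey_class : Prop :=
  [/\ all_finite, hereditary, joint_embedding & ramsey_property].

End Ramsey.

Inductive oh_sym := LtSym | HypSym.

Definition oh_lang (n : nat) : language :=
  {| funsym := void;
     relsym := oh_sym;
     funar := fun=> 0;
     relar := fun r => if r is LtSym then 2 else n |}.

Definition lin_lang : language :=
  {| funsym := void; relsym := unit; funar := fun=> 0; relar := fun=> 2 |}.

Definition empty_lang : language :=
  {| funsym := void; relsym := void; funar := fun=> 0; relar := fun=> 0 |}.

Definition pair_vec (D : Type) (x y : D) : 'I_2 -> D :=
  fun i => if i == ord0 then x else y.

Section OrderedHypergraph.
Variables (n : nat) (D : Type) (H : structure (oh_lang n) D).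

Definition oh_lt (x y : D) : Prop := @rint (oh_lang n) D H LtSym (pair_vec x y).

Definition oh_edge (v : 'I_n -> D) : Prop := @rint (oh_lang n) D H HypSym v.

Definition is_ordered_hypergraph : Prop :=
  [/\ (forall x, ~ oh_lt x x),
      (forall x y z, oh_lt x y -> oh_lt y z -> oh_lt x z),
      (forall x y, [\/ oh_lt x y, x = y | oh_lt y x]),
      (forall v, oh_edge v -> injective v)
    & (forall (s : 'S_n) v, oh_edge v -> oh_edge (v \o s))].

Definition order_part : structure lin_lang D :=
  {| fint := fun f : funsym lin_lang => match f with end;
     rint := fun (_ : relsym lin_lang) => @rint (oh_lang n) D H LtSym |}.

End OrderedHypergraph.

Definition finite_ordered_hypergraph (n : nat) : struct_class (oh_lang n) :=
  fun D A => finite_set [set: D] /\ is_ordered_hypergraph A.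

Definition pure_set (D : Type) : structure empty_lang D :=
  {| fint := fun f : funsym empty_lang => match f with end;
     rint := fun r : relsym empty_lang => match r with end |}.

(* Main.v *)
(**
Let [M] be a reduct whose age is Ramsey.  Colour copies in [M] of its
substructures on 2 and on [n] points by the order type, respectively the edge
relation, which [OH] puts on them.  The Ramsey property yields, for every finite
subset [P] of [D], an embedding [g : M|P -> M] along which the pulled back order
and edges depend only on the quantifier-free [M]-type.  There are finitely many
colour patterns, so by compactness one of them works for all [P]: this gives
an order [lt'] and a hypergraph [edge'] on [D], both definable in [M], such that
[M] is defined from them in the way it is defined from [OH].  Since [lt'] and
[edge'] are also definable in [OH], [lt'] is [<] or its converse, and on injective
tuples [edge'] is the edge relation, its complement, everything or nothing.  In
the first two cases [M] is interdefinable with [OH], in the last two with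
[(D, <)].
*)

Require Import Defs.
From mathcomp Require Import all_boot all_fingroup.
From mathcomp Require Import boolp classical_sets functions cardinality.

Set Implicit Arguments.
Unset Strict Implicit.
Unset Printing Implicit Defensive.

Local Open Scope classical_set_scope.


(** * Tuples, embeddings and automorphisms *)

Lemma vsnoc_lift (D : Type) k (v : 'I_k -> D) d i : vsnoc v d (lift ord_max i) = v i.
Proof. by rewrite /vsnoc liftK. Qed.

Lemma vsnoc_max (D : Type) k (v : 'I_k -> D) d : vsnoc v d ord_max = d.
Proof. by rewrite /vsnoc unlift_none. Qed.

Lemma comp_vsnoc (D E : Type) (h : D -> E) k (v : 'I_k -> D) d :
  h \o vsnoc v d = vsnoc (h \o v) (h d).
Proof. by apply: funext => i /=; rewrite /vsnoc; case: unlift. Qed.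

Lemma comp_pair_vec (D E : Type) (h : D -> E) x y :
  h \o pair_vec x y = pair_vec (h x) (h y).
Proof. by apply: funext => i /=; rewrite /pair_vec; case: ifP. Qed.

Lemma ord2_neq0 (i : 'I_2) : i <> ord0 -> i = ord_max.
Proof.
case: i => -[|[|m]] // h ne; last exact: val_inj.
by case: ne; apply: val_inj.
Qed.

Lemma pair_vecE (D : Type) (v : 'I_2 -> D) : pair_vec (v ord0) (v ord_max) = v.
Proof.
by apply: funext => i; rewrite /pair_vec; case: eqP => [->//|/ord2_neq0->].
Qed.

Lemma pair_vec_injective (D : Type) (x y : D) : x <> y -> injective (pair_vec x y).
Proof.
move=> xy i j; rewrite /pair_vec.
case: eqP => [->|i0]; case: eqP => [->|j0] // e; first by case: (xy (esym e)).
by rewrite (ord2_neq0 i0) (ord2_neq0 j0).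
Qed.

Lemma graph_vsnoc (D : Type) k (F : ('I_k -> D) -> D) v d :
  graph F (vsnoc v d) <-> F v = d.
Proof.
rewrite /graph vsnoc_max (_ : (fun i => _) = v) //.
by apply: funext => i; rewrite vsnoc_lift.
Qed.

Lemma embedding_comp L (D E F : Type) (A : structure L D) (B : structure L E)
    (C : structure L F) g h :
  is_embedding B C g -> is_embedding A B h -> is_embedding A C (g \o h).
Proof.
move=> [gI gf gr] [hI hf hr]; split=> [|f v|r v].
- exact: inj_comp.
- by rewrite /= hf gf.
- by rewrite hr gr.
Qed.

Lemma eval_embedding L (D E : Type) (A : structure L D) (B : structure L E) h :
  is_embedding A B h ->
  forall k (v : 'I_k -> D) (t : term L k), h (eval A v t) = eval B (h \o v) t.
Proof.
move=> [_ hf _] k v; elim=> [//|f ts IH] /=.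
by rewrite hf; congr fint; apply: funext => i /=.
Qed.

Lemma sat_automorphism L (D : Type) (M : structure L D) s :
  is_automorphism M s ->
  forall k (phi : formula L k) v, sat M phi v <-> sat M phi (s \o v).
Proof.
move=> [sE sB] k phi; have [sI _ sr] := sE.
elim: phi => {k} [k|k t u|k r ts|k phi IH1 psi IH2|k phi IH] v //=.
- by rewrite -!(eval_embedding sE); split=> [->//|/sI].
- rewrite sr (_ : _ \o _ = (fun i => eval M (s \o v) (ts i))) //.
  by apply: funext => i /=; rewrite (eval_embedding sE).
- by rewrite IH1 IH2.
- split=> H d.
    (* Surjectivity of [s] writes every quantified point [d] as an image. *)
    have [s' _ s'K] := sB; rewrite -(s'K d) -comp_vsnoc.
    by rewrite -IH.
  by rewrite IH comp_vsnoc.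
Qed.

Lemma reduct_automorphism L1 L2 (D : Type) (M : structure L1 D) (N : structure L2 D) s :
  fo_reduct M N -> is_automorphism N s -> is_automorphism M s.
Proof.
move=> [Mr Mf] sN; have [[sI _ _] sB] := sN; split=> //; split=> // [f v|r v].
  have [phi phiP] := Mf f.
  have /phiP/(sat_automorphism sN)/phiP : graph (@fint _ _ M f) (vsnoc v (fint M v)).
    exact/graph_vsnoc.
  by rewrite comp_vsnoc => /graph_vsnoc.
have [phi phiP] := Mr r.
by rewrite -!phiP (sat_automorphism sN).
Qed.

(** * Substructures on arbitrary subsets *)

Lemma finitely_generated_finite L (X : Type) (A : structure L X) :
  finite_set [set: X] -> finitely_generated A.
Proof. by move=> fX; exists setT => // P sP _; apply/seteqP. Qed.

(* Every subset of the domain then carries a substructure. *)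
Definition conservative L (D : Type) (M : structure L D) :=
  forall (f : funsym L) v, exists i, v i = @fint L D M f v.

Lemma conservative_comp L (D : Type) (M : structure L D) (hM : conservative M)
    (X : Type) (u : X -> D) (f : funsym L) (v : 'I_(funar f) -> X) :
  exists x, u x = fint M (u \o v).
Proof. by have [i <-] := hM f (u \o v); exists (v i). Qed.

(** When [u] is injective this is the induced structure making [u] an embedding; otherwise the value
    picked by [cid] is just some preimage. *)
Definition pull L (D : Type) (M : structure L D) (hM : conservative M)
    (X : Type) (u : X -> D) : structure L X :=
  {| fint := fun f v => projT1 (cid (conservative_comp hM u v));
     rint := fun r v => rint M (u \o v) |}.

Lemma pull_embedding L (D : Type) (M : structure L D) (hM : conservative M)
    (X : Type) (u : X -> D) :
  injective u -> is_embedding (pull hM u) M u.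
Proof. by move=> uI; split=> // f v /=; case: cid. Qed.

Lemma age_pull L (D : Type) (M : structure L D) (hM : conservative M)
    (X : Type) (u : X -> D) :
  finite_set [set: X] -> injective u -> age M (pull hM u).
Proof.
move=> fX uI; split; first exact: finitely_generated_finite.
by exists u; apply: pull_embedding.
Qed.

Lemma finite_set_type (T : Type) (P : set T) : finite_set P -> finite_set [set: P].
Proof.
move=> fP; have -> : [set: P] = \val @^-1` P.
  by apply/seteqP; split=> // x _ /=; exact: set_valP.
by apply: finite_preimage => // x y _ _; apply: val_inj.
Qed.

Lemma finite_range k (T : Type) (u : 'I_k -> T) : finite_set (range u).
Proof. by apply: finite_image; apply: finite_finset. Qed.

(** * Types and homogeneity in the ordered random hypergraph *)

(** Equality is left out because irreflexivity and trichotomy of the order recover it, see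
    [oh_equiv_eq]. *)
Definition oh_equiv n (D E X : Type) (A : structure (oh_lang n) D)
    (B : structure (oh_lang n) E) (u : X -> D) (v : X -> E) :=
  (forall i j, oh_lt A (u i) (u j) <-> oh_lt B (v i) (v j)) /\
  (forall w : 'I_n -> X, oh_edge A (u \o w) <-> oh_edge B (v \o w)).

Lemma oh_equiv_embedding n (D E : Type) (A : structure (oh_lang n) D)
    (B : structure (oh_lang n) E) h :
  is_embedding A B h <-> injective h /\ oh_equiv A B id h.
Proof.
split=> [[hI _ hr]|[hI [hl he]]].
  split=> //; split=> [i j|w]; first by rewrite /oh_lt hr comp_pair_vec.
  by rewrite /oh_edge hr.
split=> // -[] v; last exact: he.
by rewrite -(pair_vecE v) comp_pair_vec; apply: hl.
Qed.

Lemma oh_equiv_sym n (D E X : Type) (A : structure (oh_lang n) D)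
    (B : structure (oh_lang n) E) (u : X -> D) (v : X -> E) :
  oh_equiv A B u v -> oh_equiv B A v u.
Proof. by move=> [e1 e2]; split=> *; split; (move/e1 || move/e2). Qed.

Section FraisseOH.
Variables (n : nat) (D : Type) (OH : structure (oh_lang n) D).
Hypothesis hOH : fraisse_limit (@finite_ordered_hypergraph n) OH.

Lemma oh_conservative : conservative OH. Proof. by case. Qed.

(** Each axiom concerns finitely many points; these lie in a finite substructure, which belongs to
    the age and hence to the class. *)
Lemma oh_axioms : is_ordered_hypergraph OH.
Proof.
have sub (P : set D) : finite_set P -> is_ordered_hypergraph (pull oh_conservative (\val : P -> D)).
  move=> fP; case: hOH => _ _ /(_ _ (pull oh_conservative (\val : P -> D))) [+ _].
  case; last by [].
  by apply: age_pull; [exact: finite_set_type | exact: val_inj].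
have ltE (P : set D) (x y : P) :
    oh_lt (pull oh_conservative (\val : P -> D)) x y = oh_lt OH (val x) (val y).
  by rewrite /oh_lt /= comp_pair_vec.
have pt3 x y z : exists (P : set D) (a b c : P), [/\ finite_set P, x = val a, y = val b & z = val c].
  exists [set x; y; z].
  have hx : x \in [set x; y; z] by apply/mem_set; left; left.
  have hy : y \in [set x; y; z] by apply/mem_set; left; right.
  have hz : z \in [set x; y; z] by apply/mem_set; right.
  by exists (SigSub hx), (SigSub hy), (SigSub hz).
have lft (v : 'I_n -> D) : exists (P : set D) (v' : 'I_n -> P), finite_set P /\ v = val \o v'.
  exists (range v).
  have h i : v i \in range v by apply/mem_set; exists i.
  by exists (fun i => SigSub (h i)); split=> //; apply: finite_range.
split=> [x|x y z|x y|v|s v].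
- have [P [a [b [c [fP -> _ _]]]]] := pt3 x x x.
  by rewrite -ltE; case: (sub P fP) => + _ _ _ _; apply.
- have [P [a [b [c [fP -> -> ->]]]]] := pt3 x y z.
  by rewrite -!ltE; case: (sub P fP) => _ + _ _ _; apply.
- have [P [a [b [c [fP -> -> _]]]]] := pt3 x y y.
  rewrite -!ltE; case: (sub P fP) => _ _ + _ _ => /(_ a b) [] h.
  + by constructor 1.
  + by constructor 2; rewrite h.
  + by constructor 3.
- have [P [v' [fP ->]]] := lft v.
  case: (sub P fP) => _ _ _ + _ => /(_ v') h e.
  by apply: inj_comp; [exact: val_inj | exact: h].
- have [P [v' [fP ->]]] := lft v.
  by case: (sub P fP) => _ _ _ _; apply.
Qed.

Lemma oh_realize (X : Type) (A : structure (oh_lang n) X) :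
  finite_set [set: X] -> is_ordered_hypergraph A ->
  exists2 h : X -> D, injective h & oh_equiv A OH id h.
Proof.
move=> fX hA; case: hOH => _ _ /(_ _ A) [_ []] // _ [h].
by move=> /oh_equiv_embedding[hI he]; exists h.
Qed.

Lemma oh_equiv_eq (X : Type) (u v : X -> D) :
  oh_equiv OH OH u v -> forall i j, u i = u j <-> v i = v j.
Proof.
case: oh_axioms => irr _ tri _ _ [h _] i j; split=> e.
  case: (tri (v i) (v j)) => // /h; rewrite e => /irr //.
by case: (tri (u i) (u j)) => // /h; rewrite e => /irr.
Qed.

(** Homogeneity speaks of embeddings, so repetitions in [u] are removed first: the substructure on
    the range of [u] embeds by inclusion and by [v \o ix], where [ix] picks an index of each
    point. *)
Lemma oh_homogeneous k (u v : 'I_k -> D) :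
  oh_equiv OH OH u v -> exists2 s, is_automorphism OH s & s \o u = v.
Proof.
move=> uv; have uveq := oh_equiv_eq uv.
pose P := range u.
have idx (p : P) : exists i, u i = val p by have [i _] := set_valP p; exists i.
pose ix p := projT1 (cid (idx p)).
have ixE p : u (ix p) = val p by rewrite /ix; case: cid.
have e1 : is_embedding (pull oh_conservative (\val : P -> D)) OH \val.
  by apply: pull_embedding; apply: val_inj.
have e2 : is_embedding (pull oh_conservative (\val : P -> D)) OH (v \o ix).
  apply/oh_equiv_embedding; split=> [p q /= /uveq|].
    by rewrite !ixE => /val_inj.
  have [h1 h2] := uv; split=> [p q|w] /=.
    by rewrite -h1 !ixE /oh_lt /= comp_pair_vec.
  rewrite compA -[X in oh_edge OH X]/(v \o (ix \o w)) -h2.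
  by rewrite (_ : u \o _ = val \o w) //; apply: funext => i /=; rewrite ixE.
have [_ hom _] := hOH.
have fg : finitely_generated (pull oh_conservative (\val : P -> D)).
  apply: finitely_generated_finite; apply: finite_set_type; exact: finite_range.
have [s sA se] := hom _ _ _ _ fg e1 e2.
exists s => //; apply: funext => i /=.
have ui : u i \in P by apply/mem_set; exists i.
have := congr1 (fun f => f (SigSub ui)) se => /= ->.
by apply/uveq; rewrite ixE.
Qed.

(* Double [d] to a point [None] right above it with the same edges, in the finite
   substructure on [v] and [d]; homogeneity then moves [d] to the double. *)
Lemma oh_twin k (v : 'I_k -> D) d : (forall i, v i <> d) ->
  exists2 s, is_automorphism OH s & s \o v = v /\ s d <> d.
Proof.
move=> vd; pose u := vsnoc v d; pose P := range u.
have [irr tra tri einj esym] := oh_axioms.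
have uP i : u i \in P by apply/mem_set; exists i.
pose u' i : P := SigSub (uP i).
pose p0 : P := u' ord_max.
have p0E : val p0 = d by rewrite /= /u vsnoc_max.
pose pi (x : option P) : D := val (odflt p0 x).
(* [pi] collapses the double onto [d]. The order is pulled back along it, with the tie between
   [Some p0] and [None] broken upwards; no edge contains both, since a pulled back edge is
   injective. *)
pose A : structure (oh_lang n) (option P) :=
  {| fint := fun f : funsym (oh_lang n) => match f with end;
     rint := fun r => match r return ('I_(relar (l := oh_lang n) r) -> option P) -> Prop with
       | LtSym => fun w => oh_lt OH (pi (w ord0)) (pi (w ord_max)) \/
            (w ord0 = Some p0 /\ w ord_max = None)
       | HypSym => fun w => oh_edge OH (pi \o w) end |}.
have ltA x y : oh_lt A x y <-> oh_lt OH (pi x) (pi y) \/ (x = Some p0 /\ y = None) by [].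
have fA : finite_set [set: option P].
  have -> : [set: option P] = None |` (Some @` setT).
    by apply/seteqP; split=> // -[x|] _; [right; exists x | left].
  rewrite finite_setU; split=> //; apply: finite_image; apply: finite_set_type.
  exact: finite_range.
have [|h hI [hl he]] := oh_realize (A := A) fA.
  split=> [x|x y z|x y|w|s w].
  - by move/ltA => [/irr|[->]].
  - move=> /ltA[a|[-> ->]] /ltA[b|[e1 ->]]; apply/ltA => //.
    + by left; apply: tra b.
    + by left; move: a; rewrite e1.
    + by left.
  - have [a|a|a] := tri (pi x) (pi y).
    + by constructor 1; apply/ltA; left.
    + case: x y a => [x|] [y|] a.
      * by constructor 2; congr Some; apply: val_inj.
      * constructor 1; apply/ltA; right; split=> //; congr Some; exact: val_inj.
      * constructor 3; apply/ltA; right; split=> //; congr Some; exact: val_inj.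
      * by constructor 2.
    + by constructor 3; apply/ltA; left.
  - by move/einj => wI i j e; apply: wI; rewrite /= e.
  - by move=> /(esym s).
have e1 : oh_equiv OH OH (h \o Some \o u') u.
  split=> [i j|w].
    by split=> [/hl/ltA[]// []//|hij]; apply/hl/ltA; left.
  rewrite [X in oh_edge OH X](_ : _ = h \o (Some \o u' \o w)) //.
  by rewrite -he.
(* Realizing [A] gives only a copy of [u]; homogeneity carries this copy onto [u], and [d'] is where
   the double goes. *)
have [s0 s0A s0E] := oh_homogeneous e1.
have [[s0I _ _] _] := s0A.
have s0u i : s0 (h (Some (u' i))) = u i by rewrite -[RHS](congr1 (fun f => f i) s0E).
have /oh_equiv_embedding[_ [s0l s0e]] : is_embedding OH OH s0 by case: s0A.
pose d' := s0 (h None).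
pose t := vsnoc (fun i => Some (u' (lift ord_max i))) None : 'I_k.+1 -> option P.
have tE : vsnoc v d' = s0 \o h \o t.
  rewrite /t comp_vsnoc; congr vsnoc; apply: funext => i /=.
  by rewrite s0u /u vsnoc_lift.
have pit i : pi (t i) = u i.
  by rewrite /t /u; case: (unliftP ord_max i) => [j|] ->; rewrite ?vsnoc_lift ?vsnoc_max /pi /= /u ?vsnoc_lift ?vsnoc_max.
have e2 : oh_equiv OH OH u (vsnoc v d').
  rewrite tE; split=> [i j|w] /=.
    rewrite -s0l -hl; split=> [H|/ltA[|[]]]; first by apply/ltA; left; rewrite !pit.
      by rewrite !pit.
    (* The tie would need [t i = Some p0], that is, an entry of [v] equal to [d]. *)
    rewrite /t; case: (unliftP ord_max i) => [l|] ->; rewrite ?vsnoc_lift ?vsnoc_max //.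
    move=> [] e; case: (vd l); move: e; rewrite /u' /u vsnoc_lift.
    by rewrite vsnoc_max.
  rewrite [X in _ <-> oh_edge OH X](_ : _ = s0 \o (h \o (t \o w))) //.
  rewrite -s0e -he /oh_edge /= (_ : u \o w = pi \o (t \o w)) //.
  by apply: funext => i /=; rewrite pit.
have [s sA sE] := oh_homogeneous e2.
exists s => //; move: sE; rewrite /u comp_vsnoc => sE; split.
  by apply: funext => i; have := congr1 (fun f => f (lift ord_max i)) sE; rewrite !vsnoc_lift.
have := congr1 (fun f => f ord_max) sE; rewrite !vsnoc_max => -> dd.
have : h None = h (Some p0) by apply: s0I; rewrite -/d' s0u dd /u vsnoc_max.
by move/hI.
Qed.

(** Automorphisms of [OH] are automorphisms of [M], so a value outside the arguments would be moved
    by the automorphism of [oh_twin], which fixes the arguments. In arity 0 this excludes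
    constants. *)
Lemma reduct_conservative L (M : structure L D) : fo_reduct M OH -> conservative M.
Proof.
move=> MO f v; have [//|no] := pselect (exists i, v i = fint M v).
have vd i : v i <> fint M v by move=> e; apply: no; exists i.
have [s sA [sv sd]] := oh_twin vd.
have [[_ sf _] _] := reduct_automorphism MO sA.
by case: sd; rewrite sf sv.
Qed.

End FraisseOH.


(** * Definable sets *)

Section Definability.
Variables (L : language) (D : Type) (M : structure L D) (k : nat).
Implicit Types X Y : ('I_k -> D) -> Prop.

Lemma definable_iff X Y : (forall v, X v <-> Y v) -> definable M X -> definable M Y.
Proof. by move=> XY [phi phiP]; exists phi => v; rewrite phiP XY. Qed.

Lemma definable_imp X Y :
  definable M X -> definable M Y -> definable M (fun v => X v -> Y v).
Proof.
by move=> [phi phiP] [psi psiP]; exists (Imp phi psi) => v /=; rewrite phiP psiP.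
Qed.

Lemma definable_const (P : Prop) : definable M (fun _ : 'I_k -> D => P).
Proof.
case: (pselect P) => p.
  by exists (Imp (Bot L k) (Bot L k)) => v /=; split.
by exists (Bot L k) => v /=; split.
Qed.

Lemma definable_not X : definable M X -> definable M (fun v => ~ X v).
Proof. by move=> hX; apply: definable_imp => //; apply: definable_const. Qed.

Lemma definable_and X Y :
  definable M X -> definable M Y -> definable M (fun v => X v /\ Y v).
Proof.
move=> hX hY; apply: (@definable_iff (fun v => ~ (X v -> ~ Y v))).
  move=> v; split=> [H|[x y] /(_ x)//].
  by split; apply: contrapT => h; apply: H => // x y; apply: h.
by apply: definable_not; apply: definable_imp => //; apply: definable_not.
Qed.

Lemma definable_forall (T : finType) (Y : T -> ('I_k -> D) -> Prop) :
  (forall t, definable M (Y t)) -> definable M (fun v => forall t, Y t v).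
Proof.
move=> hY; suff H (s : seq T) : definable M (fun v => forall t, t \in s -> Y t v).
  apply: definable_iff (H (enum T)) => v; split=> h t; last by move=> _.
  by apply: h; rewrite mem_enum.
elim: s => [|t s IH].
  by apply: definable_iff (definable_const True) => v; split.
apply: definable_iff (definable_and (hY t) IH) => v; split=> [[h1 h2] t'|h].
  by rewrite inE => /orP[/eqP->|/h2].
by split=> [|t' ts]; apply: h; rewrite inE ?eqxx ?ts ?orbT.
Qed.

Lemma definable_exists (T : finType) (Y : T -> ('I_k -> D) -> Prop) :
  (forall t, definable M (Y t)) -> definable M (fun v => exists t, Y t v).
Proof.
move=> hY; apply: (@definable_iff (fun v => ~ forall t, ~ Y t v)) => [v|].
  split=> [|[t Yt] /(_ t)//].
  by move=> H; apply: contrapT => N; apply: H => t Yt; apply: N; exists t.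
by apply: definable_not; apply: definable_forall => t; apply: definable_not.
Qed.

(** [f] has finitely many fibres, so one separating set for each pair of fibres suffices, and [X] is
    a finite Boolean combination of these. Definability thus follows from invariance even when the
    language is infinite. *)
Lemma definable_separation (T : finType) (f : ('I_k -> D) -> T) X :
  (forall v w,
    (forall Y, definable M Y -> (forall v' w', f v' = f w' -> Y v' -> Y w') -> Y v -> Y w) ->
    X v -> X w) ->
  definable M X.
Proof.
move=> sep.
(* If no set separated the fibres [t.1] and [t.2], the empty set would do vacuously, because [sep]
   would put [w] in [X]. *)
have /choice[Y hY] (t : T * T) : exists Y, definable M Y /\
    forall v w, f v = t.1 -> f w = t.2 -> X v -> ~ X w -> Y v /\ ~ Y w.
  apply: contrapT => no; apply: (no); exists (fun=> False).
  split=> [|v w ft1 ft2 Xv Xw]; first exact: definable_const.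
  case: Xw; apply: sep Xv => Y dY fY Yv; apply: contrapT => Yw.
  apply: no; exists Y; split=> // v' w' f1 f2 _ _; split.
    by apply: fY Yv; rewrite f1.
  by move=> /fY-/(_ w) h; apply/Yw/h; rewrite f2.
(* Union over the fibres that meet [X] of the intersection of the sets separating that fibre from
   those meeting the complement. The two meeting conditions do not depend on [v]. *)
apply: (@definable_iff (fun v => exists t, (exists2 v0, f v0 = t & X v0) /\
    forall t', (exists2 w0, f w0 = t' & ~ X w0) -> Y (t, t') v)); last first.
  apply: definable_exists => t; apply: definable_and; first exact: definable_const.
  apply: definable_forall => t'; apply: definable_imp; first exact: definable_const.
  by case: (hY (t, t')).
move=> v; split=> [[t [[v0 ft Xv0] H]]|Xv].
  apply: contrapT => nXv; have [_ /(_ v0 v)] := hY (t, f v).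
  by case=> // _; apply; apply: H; exists v.
exists (f v); split; first by exists v.
by move=> t' [w0 ft' nX]; have [_ /(_ v w0)[]] := hY (f v, t').
Qed.

End Definability.

(** * Quantifier-free types in the reduct *)

(** Only unnested atomic formulas are compared. When [M] is conservative every function value is an
    argument, so this already makes [u i |-> v i] an isomorphism between the substructures on the
    two ranges. *)
Definition qf_equiv L (D X : Type) (M : structure L D) (u v : X -> D) :=
  [/\ forall i j, u i = u j <-> v i = v j,
      forall (f : funsym L) w x, fint M (f := f) (u \o w) = u x <-> fint M (v \o w) = v x
    & forall (r : relsym L) w, rint M (r := r) (u \o w) <-> rint M (v \o w)].

Lemma qf_equiv_refl L (D X : Type) (M : structure L D) (u : X -> D) : qf_equiv M u u.
Proof. by []. Qed.

Lemma qf_equiv_trans L (D X : Type) (M : structure L D) (u v w : X -> D) :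
  qf_equiv M u v -> qf_equiv M v w -> qf_equiv M u w.
Proof.
move=> [u1 u2 u3] [v1 v2 v3]; split=> [i j|f i j|r i].
- by rewrite u1 v1.
- by rewrite u2 v2.
- by rewrite u3 v3.
Qed.

Lemma qf_equiv_sym L (D X : Type) (M : structure L D) (u v : X -> D) :
  qf_equiv M u v -> qf_equiv M v u.
Proof.
by move=> [u1 u2 u3]; split=> *; split; (move/u1 || move/u2 || move/u3).
Qed.

Lemma qf_equiv_automorphism L (D X : Type) (M : structure L D) (u : X -> D) s :
  is_automorphism M s -> qf_equiv M u (s \o u).
Proof.
move=> [[sI sf sr] _]; split=> [i j|f w x|r w].
- by split=> [/= ->//|/sI].
- by rewrite -compA -sf; split=> [->//|/sI].
- by rewrite -compA -sr.
Qed.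

Lemma qf_equiv_comp L (D X Y : Type) (M : structure L D) (u v : X -> D) (h : Y -> X) :
  qf_equiv M u v -> qf_equiv M (u \o h) (v \o h).
Proof. by move=> [e1 e2 e3]; split=> *; [apply: e1 | apply: e2 | apply: e3]. Qed.

Lemma qf_equiv_graph L (D : Type) (M : structure L D) (f : funsym L) u v :
  qf_equiv M u v -> graph (@fint _ _ M f) u -> graph (@fint _ _ M f) v.
Proof. by move=> [_ e _] /(e f (lift ord_max) ord_max). Qed.

Lemma qf_equiv_rint L (D : Type) (M : structure L D) (r : relsym L) u v :
  qf_equiv M u v -> rint M (r := r) u -> rint M v.
Proof. by move=> [_ _ e] /(e r id). Qed.

Lemma qf_equiv_pull L (D E X : Type) (M : structure L D) (hM : conservative M)
    (b : E -> D) (g : E -> D) (u : X -> E) :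
  injective b -> is_embedding (pull hM b) M g -> qf_equiv M (b \o u) (g \o u).
Proof.
move=> bI [gI gf gr]; split=> [i j|f w x|r w].
- by split=> [/bI/(congr1 g)|/gI/(congr1 b)].
- have := gf f (u \o w); rewrite /=; case: cid => y /= e <-.
  by rewrite -[X in X = _]e; split=> [/bI ->//|/gI ->].
- exact: (gr r (u \o w)).
Qed.

Lemma pull_qf_equiv L (D X Y : Type) (M : structure L D) (hM : conservative M)
    (u : X -> D) (b : Y -> D) h :
  injective u -> injective b -> qf_equiv M u (b \o h) ->
  is_embedding (pull hM u) (pull hM b) h.
Proof.
move=> uI bI [e1 e2 e3]; split=> [i j hij|f v|r v].
- by apply/uI/e1; rewrite /= hij.
- apply: bI => /=; case: cid => x /= ux; case: cid => y /= ->.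
  by apply/esym/e2; rewrite ux.
- exact: e3.
Qed.

(** * Simultaneous Ramsey and compactness *)

(** Induction on the list. The Ramsey property for [A i] and [B] gives [C]; by induction the other
    colourings become constant on a copy of [C] in [M], and the colouring for [i], pulled back to
    [C], then becomes constant on a copy of [B] inside it. *)
Lemma ramsey_simultaneous L (D : Type) (M : structure L D)
    (I : eqType) (ar : I -> nat) (A : forall i, structure L 'I_(ar i))
    (chi : forall i, ('I_(ar i) -> D) -> bool) (s : seq I) :
  ramsey_property (age M) ->
  forall (E : Type) (B : structure L E), age M B ->
  exists2 g, is_embedding B M g &
    forall i, i \in s -> exists c, forall h,
      is_embedding (A i) B h -> chi i (g \o h) = c.
Proof.
move=> ram; elim: s => [|i s IH] E B ageB.
  by have [_ [g gE]] := ageB; exists g.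
have [AB|nAB] := pselect (embeds (A i) B); last first.
  have [g gE gs] := IH E B ageB; exists g => // j; rewrite inE => /orP[/eqP->|/gs//].
  by exists true => h hE; case: nAB; exists h.
have ageA : age M (A i).
  have [_ [g gE]] := ageB; have [h hE] := AB.
  split; first by apply: finitely_generated_finite; apply: finite_finset.
  by exists (g \o h); apply: embedding_comp hE.
have [F [C [ageC hC]]] := ram _ _ _ _ ageA ageB AB.
have [g0 g0E g0s] := IH F C ageC.
have [g gE [c gc]] := hC (fun h => chi i (g0 \o h)).
exists (g0 \o g); first exact: embedding_comp gE.
move=> j; rewrite inE => /orP[/eqP->|/g0s[c' c'P]].
  exists c => h hE; rewrite -compA; apply: gc; first exact: embedding_comp hE.
  by move=> _ [x _ <-]; exists (h x).
by exists c' => h hE; rewrite -compA; apply: c'P; apply: embedding_comp hE.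
Qed.

(** Otherwise choose for each [c] a finite set on which it fails; the union of these finitely many
    sets would admit no [c] at all. *)
Lemma finite_compactness (D : Type) (C : finType) (G : set D -> C -> Prop) :
  (forall P Q c, P `<=` Q -> G Q c -> G P c) ->
  (forall P, finite_set P -> exists c, G P c) ->
  exists c, forall P, finite_set P -> G P c.
Proof.
move=> Gmono Gex; apply: contrapT => no.
have /choice[P hP] c : exists P, finite_set P /\ ~ G P c.
  apply: contrapT => noP; apply: no; exists c => P fP.
  by apply: contrapT => nG; apply: noP; exists P.
have [|c Gc] := Gex (\bigcup_(c in setT) P c).
  by apply: bigcup_finite => [|c _]; [exact: finite_finset | case: (hP c)].
by case: (hP c) => _; apply; apply: Gmono Gc => x Px; exists c.
Qed.


(** * Canonical copies and the expansion they define *)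

Section Expansion.
Variables (n : nat) (D : Type) (OH : structure (oh_lang n) D).
Hypothesis hOH : fraisse_limit (@finite_ordered_hypergraph n) OH.

(** A finite type, so that there are finitely many colour patterns on it and [finite_compactness]
    applies. *)
Definition otype_of k : finType :=
  ({ffun 'I_k * 'I_k -> bool} * {ffun {ffun 'I_n -> 'I_k} -> bool})%type.

Definition otype k (u : 'I_k -> D) : otype_of k :=
  ([ffun ij => `[< oh_lt OH (u ij.1) (u ij.2) >]],
   [ffun w : {ffun 'I_n -> 'I_k} => `[< oh_edge OH (u \o w) >]]).

Lemma otypeP k (u v : 'I_k -> D) : otype u = otype v <-> oh_equiv OH OH u v.
Proof.
split=> [[/ffunP e1 /ffunP e2]|[e1 e2]].
  split=> [i j|w].
    have := e1 (i, j); rewrite !ffunE /= => e.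
    by rewrite -[X in X <-> _]asboolE e asboolE.
  have := e2 (finfun w); rewrite !ffunE.
  rewrite (_ : (finfun w : _ -> _) = w); last by apply: funext => i; rewrite ffunE.
  by move=> e; rewrite -[X in X <-> _]asboolE e asboolE.
by congr pair; apply/ffunP => x; rewrite !ffunE; apply: asbool_equiv_eq.
Qed.

Lemma oh_inhabited : exists d : D, True.
Proof.
pose A : structure (oh_lang n) unit :=
  {| fint := fun f : funsym (oh_lang n) => match f with end;
     rint := fun r _ => False |}.
have [||h _ _] := oh_realize hOH (A := A); last by exists (h tt).
  exact: finite_finset.
by split=> // -[] []; constructor 2.
Qed.

Variables (L : language) (M : structure L D).
Hypothesis MO : fo_reduct M OH.

(** By homogeneity the tuples are conjugate under an automorphism of [OH], which is also one of
    [M]. *)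
Lemma oh_equiv_qf_equiv k (u v : 'I_k -> D) : oh_equiv OH OH u v -> qf_equiv M u v.
Proof.
move=> /(oh_homogeneous hOH)[s sA <-].
exact: qf_equiv_automorphism (reduct_automorphism MO sA).
Qed.

Let hM : conservative M := reduct_conservative hOH MO.
Local Notation sub P := (pull hM (\val : set_type P -> D)).

Lemma ramsey_canonical_copy (P : set D) :
  ramsey_property (age M) -> finite_set P ->
  exists g : P -> D, [/\ is_embedding (sub P) M g,
    forall x y z w : P, x <> y ->
      qf_equiv M (pair_vec (val x) (val y)) (pair_vec (val z) (val w)) ->
      oh_lt OH (g x) (g y) -> oh_lt OH (g z) (g w)
  & forall u v : 'I_n -> P, injective u -> qf_equiv M (val \o u) (val \o v) ->
      oh_edge OH (g \o u) -> oh_edge OH (g \o v)].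
Proof.
move=> ram fP; have [d _] := oh_inhabited.
(* A representative tuple of each type that occurs; types that do not occur get a constant tuple. *)
have rep k : {r : otype_of k -> 'I_k -> D | forall u, otype (r (otype u)) = otype u}.
  have /choice[r hr] (t : otype_of k) : exists a, (exists a', otype a' = t) -> otype a = t.
    have [[a at_]|no] := pselect (exists a, otype a = t); first by exists a.
    by exists (fun=> d).
  by exists r => u; apply: hr; exists u.
pose I : finType := (otype_of 2 + otype_of n)%type.
pose ar (i : I) := if i is inl _ then 2 else n.
pose A (i : I) : structure L 'I_(ar i) :=
  match i with inl t => pull hM (sval (rep 2) t) | inr t => pull hM (sval (rep n) t) end.
pose chi (i : I) : ('I_(ar i) -> D) -> bool :=
  match i with
  | inl _ => fun h => `[< oh_lt OH (h ord0) (h ord_max) >]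
  | inr _ => fun h => `[< oh_edge OH h >] end.
have agesub : age M (sub P).
  by apply: age_pull; [exact: finite_set_type | exact: val_inj].
have [g gE gs] := ramsey_simultaneous A chi (enum I) ram agesub.
(* Both [u] itself and any [v] of the same [M]-type embed the structure on the representative, so
   they receive one colour. *)
have repE k (u v : 'I_k -> P) : injective u -> qf_equiv M (val \o u) (val \o v) ->
    is_embedding (pull hM (sval (rep k) (otype (val \o u)))) (sub P) v.
  move=> uI uv; set r := sval _ _.
  have ru : qf_equiv M r (val \o u).
    by apply/oh_equiv_qf_equiv/otypeP; rewrite /r; case: (rep k).
  apply: pull_qf_equiv; [|exact: val_inj|exact: qf_equiv_trans uv].
  by case: ru => e _ _ i j /e /val_inj/uI.
have leE (p q : Prop) : `[< p >] = `[< q >] -> p -> q.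
  by move=> e hp; apply/asboolP; rewrite -e; apply/asboolP.
exists g; split=> // [x y z w xy|u v uI uv].
  rewrite -!comp_pair_vec => eq; have pI := pair_vec_injective xy.
  have [c gc] := gs (inl (otype (val \o pair_vec x y))) (mem_enum _ _).
  by apply: leE; rewrite [LHS](gc _ (repE _ _ _ pI (qf_equiv_refl _ _)))
    [RHS](gc _ (repE _ _ _ pI eq)).
have [c gc] := gs (inr (otype (val \o u))) (mem_enum _ _).
by apply: leE; rewrite [LHS](gc _ (repE _ _ _ uI (qf_equiv_refl _ _)))
  [RHS](gc _ (repE _ _ _ uI uv)).
Qed.

(** [c] decides once for each [OH]-type, which leaves finitely many candidates. Distinctness, here
    and in [edge_of], is imposed because a pattern [c] may also accept degenerate types. *)
Definition lt_of (c : {ffun otype_of 2 -> bool}) (x y : D) :=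
  x <> y /\ c (otype (pair_vec x y)).

Definition edge_of (c : {ffun otype_of n -> bool}) (v : 'I_n -> D) :=
  injective v /\ c (otype v).

(** The third clause is how facts about the actual order and edges are later transferred to [lt']
    and [edge'], one finite tuple at a time. *)
Lemma uniform_expansion :
  ramsey_property (age M) ->
  exists (lt' : D -> D -> Prop) (edge' : ('I_n -> D) -> Prop),
  [/\ forall x y z w, qf_equiv M (pair_vec x y) (pair_vec z w) -> lt' x y -> lt' z w,
      forall u v, qf_equiv M u v -> edge' u -> edge' v
    & forall k (u : 'I_k -> D), exists v : 'I_k -> D,
      [/\ qf_equiv M u v,
          forall i j, oh_lt OH (v i) (v j) <-> lt' (u i) (u j)
        & forall w : 'I_n -> 'I_k, oh_edge OH (v \o w) <-> edge' (u \o w)]].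
Proof.
move=> ram; have [irr _ _ einj _] := oh_axioms hOH.
pose C : finType := ({ffun otype_of 2 -> bool} * {ffun otype_of n -> bool})%type.
(* The pattern [c] describes order and edges along a copy of [P]. Its [M]-invariance on [P] is made
   part of [G] so that compactness carries it to all of [D]. *)
pose G (P : set D) (c : C) := exists g : P -> D,
  [/\ is_embedding (sub P) M g,
      forall x y, oh_lt OH (g x) (g y) <-> lt_of c.1 (val x) (val y),
      forall v : 'I_n -> P, oh_edge OH (g \o v) <-> edge_of c.2 (val \o v),
      forall x y z w : P, qf_equiv M (pair_vec (val x) (val y)) (pair_vec (val z) (val w)) ->
        lt_of c.1 (val x) (val y) -> lt_of c.1 (val z) (val w)
    & forall u v : 'I_n -> P, qf_equiv M (val \o u) (val \o v) ->
        edge_of c.2 (val \o u) -> edge_of c.2 (val \o v)].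
have [P Q c PQ [g [gE gl ge gl' ge']]|P fP|c Gc] := @finite_compactness D C G.
- have PQ' (p : P) : val p \in Q by apply/mem_set/PQ/set_valP.
  pose i (p : P) : Q := SigSub (PQ' p).
  exists (g \o i); split=> [|x y|v|x y z w|u v].
  + apply: embedding_comp gE _; apply: pull_qf_equiv; try exact: val_inj.
    exact: qf_equiv_refl.
  + exact: gl.
  + exact: (ge (i \o v)).
  + exact: (gl' (i x) (i y) (i z) (i w)).
  + exact: (ge' (i \o u) (i \o v)).
- have [g [gE gl ge]] := ramsey_canonical_copy ram fP.
  (* A type is accepted if some tuple of that type is related in the copy. Tuples of one [OH]-type
     have one [M]-type, so by canonicity all tuples of the type then are, provided their entries are
     distinct. *)
  pose c1 : {ffun otype_of 2 -> bool} := [ffun t => `[< exists x y : P,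
    otype (pair_vec (val x) (val y)) = t /\ oh_lt OH (g x) (g y) >]].
  pose c2 : {ffun otype_of n -> bool} := [ffun t => `[< exists u : 'I_n -> P,
    otype (val \o u) = t /\ oh_edge OH (g \o u) >]].
  have c1P x y : oh_lt OH (g x) (g y) <-> lt_of c1 (val x) (val y).
    rewrite /lt_of ffunE; split=> [l|[ne /asboolP[x' [y' [e l]]]]].
      split; last by apply/asboolP; exists x, y.
      by move=> /val_inj e; apply: (irr (g x)); rewrite {2}e.
    apply: gl l; last by apply/oh_equiv_qf_equiv/otypeP.
    move=> xy; move/otypeP/(oh_equiv_eq hOH): e => /(_ ord0 ord_max).
    by rewrite xy /pair_vec /= => -[/(_ erefl)].
  have c2P (u : 'I_n -> P) : oh_edge OH (g \o u) <-> edge_of c2 (val \o u).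
    rewrite /edge_of ffunE; split=> [l|[uI /asboolP[u' [e l]]]].
      split; last by apply/asboolP; exists u.
      by move=> i j /val_inj e; apply: (einj _ l); rewrite /= e.
    have eq := (otypeP _ _).1 e.
    apply: ge l; last exact: oh_equiv_qf_equiv.
    by move=> i j ij; apply/uI/(oh_equiv_eq hOH eq); rewrite /= ij.
  exists (c1, c2), g; split=> //= [x y z w eq xy|u v eq hu].
    by apply/c1P; apply: gl eq _; [case: xy => + _ e; apply; rewrite e | apply/c1P].
  apply/c2P; apply: ge eq _; last exact/c2P.
  by move=> i j ij; case: hu => + _; apply; rewrite /= ij.
- exists (lt_of c.1), (edge_of c.2); split=> [x y z w|u v|k u].
  + have [|g [_ _ _ lM _]] := Gc [set x; y; z; w]; first by rewrite !finite_setU.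
    have hx : x \in [set x; y; z; w] by apply/mem_set; left; left; left.
    have hy : y \in [set x; y; z; w] by apply/mem_set; left; left; right.
    have hz : z \in [set x; y; z; w] by apply/mem_set; left; right.
    have hw : w \in [set x; y; z; w] by apply/mem_set; right.
    exact: (lM (SigSub hx) (SigSub hy) (SigSub hz) (SigSub hw)).
  + have [|g [_ _ _ _ eM]] := Gc (range u `|` range v).
      by rewrite finite_setU; split; apply: finite_range.
    have hu i : u i \in range u `|` range v by apply/mem_set; left; exists i.
    have hv i : v i \in range u `|` range v by apply/mem_set; right; exists i.
    exact: (eM (fun i => SigSub (hu i)) (fun i => SigSub (hv i))).
  + have [g [gE gl ge _ _]] := Gc (range u) (finite_range u).
    have hu i : u i \in range u by apply/mem_set; exists i.
    pose u' i : set_type (range u) := SigSub (hu i).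
    exists (g \o u'); split=> [|i j|w]; [|exact: gl|exact: (ge (u' \o w))].
    exact: (qf_equiv_pull (b := val) u' val_inj gE).
Qed.

End Expansion.


(** * Tuples in ordered hypergraphs and invariant linear orders *)

Lemma oh_edge_comp n (D : Type) (OH : structure (oh_lang n) D) (u : 'I_n -> D) w :
  is_ordered_hypergraph OH -> injective w ->
  oh_edge OH (u \o w) <-> oh_edge OH u.
Proof.
move=> [_ _ _ _ esym] wI; have wE : w = perm wI :> (_ -> _).
  by apply: funext => i; rewrite permE.
rewrite wE; split=> [|/(esym (perm wI))//].
move=> /(esym (perm wI)^-1%g); rewrite (_ : (u \o _) \o _ = u) //.
by apply: funext => i /=; rewrite permKV.
Qed.

(** A reindexing that is not injective gives an edge on neither side, and an injective one is a
    permutation, so the edge value of the whole tuple decides. *)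
Lemma oh_equiv_full n (D E : Type) (A : structure (oh_lang n) D)
    (B : structure (oh_lang n) E) (u : 'I_n -> D) (v : 'I_n -> E) :
  is_ordered_hypergraph A -> is_ordered_hypergraph B ->
  (forall i j, oh_lt A (u i) (u j) <-> oh_lt B (v i) (v j)) ->
  (oh_edge A u <-> oh_edge B v) -> oh_equiv A B u v.
Proof.
move=> hA hB uv e; split=> // w.
have [wI|wN] := pselect (injective w); first by rewrite !oh_edge_comp.
have [_ _ _ eA _] := hA; have [_ _ _ eB _] := hB.
by split=> [/eA|/eB] h; case: wN => i j wij; apply: h; rewrite /= wij.
Qed.

Lemma oh_lt_pair n (D E : Type) (A : structure (oh_lang n) D)
    (B : structure (oh_lang n) E) x y z w :
  is_ordered_hypergraph A -> is_ordered_hypergraph B ->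
  oh_lt A x y -> oh_lt B z w -> forall i j,
  oh_lt A (pair_vec x y i) (pair_vec x y j) <-> oh_lt B (pair_vec z w i) (pair_vec z w j).
Proof.
move=> [iA tA _ _ _] [iB tB _ _ _] xy zw i j; rewrite /pair_vec.
case: ifP => _; case: ifP => _; split=> // h; exfalso.
- exact: iA h.
- exact: iB h.
- exact: iA (tA _ _ _ xy h).
- exact: iB (tB _ _ _ zw h).
- exact: iA h.
- exact: iB h.
Qed.

(** The sorting permutation is the inverse of the rank map, the rank of [i] being the number of
    entries below [u i]. *)
Lemma oh_equiv_sorted n (D : Type) (OH : structure (oh_lang n) D) (u : 'I_n -> D) :
  is_ordered_hypergraph OH -> injective u ->
  exists s : 'S_n, forall i j, oh_lt OH (u (s i)) (u (s j)) <-> (i < j)%N.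
Proof.
move=> [irr tra tri _ _] uI.
pose below i := [set j | `[< oh_lt OH (u j) (u i) >]]%SET.
have belowE i j : (j \in below i) <-> oh_lt OH (u j) (u i).
  by rewrite inE; split=> /asboolP.
have rlt i : (#|below i| < n)%N.
  rewrite -[X in (_ < X)%N]card_ord -cardsT; apply: proper_card.
  rewrite properT; apply/eqP => /setP/(_ i); rewrite finset.in_setT => /belowE.
  exact: irr.
have rmono i j : oh_lt OH (u i) (u j) -> (#|below i| < #|below j|)%N.
  move=> ij; apply: proper_card; apply/properP; split.
    by apply/fintype.subsetP => l /belowE li; apply/belowE; apply: tra ij.
  by exists i; [apply/belowE | apply/negP => /belowE/irr].
have rmonoE i j : oh_lt OH (u i) (u j) <-> (#|below i| < #|below j|)%N.
  split=> [/rmono//|ij]; have [//|e|/rmono ji] := tri (u i) (u j).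
    by move: ij; rewrite (uI _ _ e) ltnn.
  by move: (ltn_trans ij ji); rewrite ltnn.
pose r i := Ordinal (rlt i).
have rI : injective r.
  move=> i j /(congr1 val) /= e; have [/rmono|/uI//|/rmono] := tri (u i) (u j);
    by rewrite e ltnn.
exists (perm rI)^-1%g => i j; rewrite rmonoE.
have val_r l : #|below ((perm rI)^-1%g l)| = l.
  by rewrite -[RHS](congr1 val (permKV (perm rI) l)) permE.
by rewrite !val_r.
Qed.

(** By [key], [lt'] has the same truth value on all increasing pairs, and trichotomy does the rest.
    For [n = 1] this fails: one could put all points of the unary relation first. *)
Lemma definable_linear_order n (D : Type) (OH : structure (oh_lang n) D)
    (lt' : D -> D -> Prop) :
  (2 <= n)%N -> fraisse_limit (@finite_ordered_hypergraph n) OH ->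
  (forall x, ~ lt' x x) -> (forall x y z, lt' x y -> lt' y z -> lt' x z) ->
  (forall x y, [\/ lt' x y, x = y | lt' y x]) ->
  (forall x y z w, oh_equiv OH OH (pair_vec x y) (pair_vec z w) -> lt' x y -> lt' z w) ->
  (forall x y, lt' x y <-> oh_lt OH x y) \/ (forall x y, lt' x y <-> oh_lt OH y x).
Proof.
move=> hn hOH irr' tra' tri' inv; have ax := oh_axioms hOH.
have [irr tra tri einj esym] := ax.
suff key x y z w : oh_lt OH x y -> oh_lt OH z w -> lt' x y -> lt' z w.
  have [[x [y [xy xy']]]|no] := pselect (exists x y, oh_lt OH x y /\ lt' x y).
    left=> z w; split=> [zw'|zw]; last exact: key xy'.
    have [//|e|wz] := tri z w; first by case: (irr' z); rewrite {2}e.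
    by case: (irr' z); apply: tra' zw' _; apply: key xy'.
  right=> z w; split=> [zw'|wz].
    have [zw|e|//] := tri z w; first by case: no; exists z, w.
    by case: (irr' z); rewrite {2}e.
  have [//|e|wz'] := tri' z w; first by case: (irr z); rewrite {1}e.
  by case: no; exists w, z.
move=> xy zw xy'; have ltpair := oh_lt_pair ax ax.
(* For [n > 2] a pair carries no edge, since edges have [n] distinct entries, so any two increasing
   pairs have one type. *)
have [n2|n3] := leqP n 2; last first.
  apply: inv xy'; split; first exact: ltpair.
  have no (p : 'I_2 -> D) w' : ~ oh_edge OH (p \o w').
    move=> /einj /inj_compr /leq_card; rewrite !card_ord => n2.
    by move: (leq_trans n3 n2).
  by move=> w'; split=> /no.
have {hn n2} n2 : n = 2 by apply/eqP; rewrite eqn_leq n2 hn.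
subst n; apply: contrapT => zw'.
(* On 3 points 0 < 1 < 2, let 01 and 12 look like [x y], and 02 like [z w]:
   if [lt'] agreed with [<] on the former only, it would not be transitive. *)
pose b : 'I_3 := inord 1.
(* Asking whether the middle point [b] occurs among the entries keeps the edges symmetric. *)
pose A : structure (oh_lang 2) 'I_3 :=
  {| fint := fun f : funsym (oh_lang 2) => match f with end;
     rint := fun r => match r return ('I_(relar (l := oh_lang 2) r) -> 'I_3) -> Prop with
       | LtSym => fun v => (v ord0 < v ord_max)%N
       | HypSym => fun v => injective v /\
           (((exists i, v i = b) /\ oh_edge OH (pair_vec x y)) \/
            ((forall i, v i <> b) /\ oh_edge OH (pair_vec z w))) end |}.
have ltA i j : oh_lt A i j <-> (i < j)%N by [].
have hA : is_ordered_hypergraph A.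
  split=> [i|i j k|i j|v|s v].
  - by move/ltA; rewrite ltnn.
  - by move=> /ltA ij /ltA jk; apply/ltA; apply: ltn_trans jk.
  - by case: (ltngtP i j) => [h|h|/val_inj h]; [constructor 1|constructor 3|constructor 2].
  - by case.
  - move=> [vI h]; split; first by apply: inj_comp => //; apply: perm_inj.
    case: h => [[[i vi] e]|[vb e]]; [left|right]; split=> //.
      by exists ((s^-1)%g i); rewrite /= permKV.
    by move=> i; apply: vb.
have [|h hI [hl he]] := oh_realize hOH (A := A) _ hA; first exact: finite_finset.
have pairE (i j : 'I_3) p q : (i < j)%N -> oh_lt OH p q ->
    (oh_edge A (pair_vec i j) <-> oh_edge OH (pair_vec p q)) ->
    oh_equiv OH OH (pair_vec (h i) (h j)) (pair_vec p q).
  move=> ij pq e; apply: oh_equiv_full => //.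
    by apply: ltpair => //; apply/hl/ltA.
  by rewrite -comp_pair_vec -he.
have bE : val b = 1%N by rewrite /b /= inordK.
have inj (i j : 'I_3) : (i < j)%N -> injective (pair_vec i j).
  by move=> ij; apply: pair_vec_injective => e; move: ij; rewrite e ltnn.
have lt1 : (@ord0 2 < b)%N by rewrite bE.
have lt2 : (b < @ord_max 2)%N by rewrite bE.
have lt3 : (@ord0 2 < @ord_max 2)%N by [].
have pq : lt' (h ord0) (h b).
  apply: inv xy'; apply/oh_equiv_sym/pairE => //; split=> [[_ [[]//|[]]]|e].
    by move=> /(_ ord_max).
  by split; [exact: inj | left; split=> //; exists ord_max].
have qr : lt' (h b) (h ord_max).
  apply: inv xy'; apply/oh_equiv_sym/pairE => //; split=> [[_ [[]//|[]]]|e].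
    by move=> /(_ ord0).
  by split; [exact: inj | left; split=> //; exists ord0].
apply: zw'; apply: inv (tra' _ _ _ pq qr); apply: pairE => //.
have nb i : pair_vec (@ord0 2) ord_max i <> b.
  by rewrite /pair_vec; case: ifP => _ /(congr1 val); rewrite bE.
split=> [[_ [[[i /nb]]//|[]//]]|e].
by split; [exact: inj | right].
Qed.


(** * Definability over the reduct and the dichotomy *)

Section Reducts.
Variables (n : nat) (D : Type) (OH : structure (oh_lang n) D).
Hypothesis hOH : fraisse_limit (@finite_ordered_hypergraph n) OH.
Variables (L : language) (M : structure L D).
Hypothesis MO : fo_reduct M OH.

(** [L] may be infinite, but [M]-types are unions of the finitely many [OH]-types, so
    [definable_separation] applies with [otype]; the separating sets are given by atomic formulas
    and their negations. *)
Lemma definable_qf_invariant k (X : ('I_k -> D) -> Prop) :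
  (forall u v, qf_equiv M u v -> X u -> X v) -> definable M X.
Proof.
move=> inv; apply: (definable_separation (f := @otype n D OH k)) => v w sep.
have {}sep Y : definable M Y -> (forall v' w', qf_equiv M v' w' -> Y v' -> Y w') ->
    Y v <-> Y w.
  move=> dY iY; have oY v' w' : otype OH v' = otype OH w' -> Y v' -> Y w'.
    by move=> /otypeP/(oh_equiv_qf_equiv hOH MO); apply: iY.
  split; first exact: sep.
  move=> Yw; apply: contrapT => nYv; apply: (sep (fun u => ~ Y u)) nYv Yw.
    exact: definable_not.
  by move=> v' w' e n' /(oY _ _ (esym e)).
apply: inv; split=> [i j|f h x|r h].
- apply: (sep (fun u => u i = u j)); last by move=> v' w' [e _ _] /e.
  by exists (Eq (Var L i) (Var L j)).
- apply: (sep (fun u => fint M (u \o h) = u x)); last by move=> v' w' [_ e _] /e.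
  by exists (Eq (App (fun i => Var L (h i))) (Var L x)).
- apply: (sep (fun u => rint M (u \o h))); last by move=> v' w' [_ _ e] /e.
  by exists (Rel (fun i => Var L (h i))).
Qed.

Lemma definable_order_invariant k (X : ('I_k -> D) -> Prop) :
  (forall u v, (forall i j, oh_lt OH (u i) (u j) <-> oh_lt OH (v i) (v j)) -> X u -> X v) ->
  definable (order_part OH) X.
Proof.
move=> inv.
pose f (u : 'I_k -> D) := [ffun ij : 'I_k * 'I_k => `[< oh_lt OH (u ij.1) (u ij.2) >]].
apply: (definable_separation (f := f)) => v w sep; apply: inv => i j.
have dY : definable (order_part OH) (fun u : 'I_k -> D => oh_lt OH (u i) (u j)).
  exists (@Rel lin_lang k tt (fun l => Var lin_lang (pair_vec i j l))) => u /=.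
  by rewrite /oh_lt -comp_pair_vec.
have fY v' w' : f v' = f w' -> oh_lt OH (v' i) (v' j) -> oh_lt OH (w' i) (w' j).
  move=> /ffunP/(_ (i, j)); rewrite !ffunE /= => e h.
  by apply/asboolP; rewrite -e; apply/asboolP.
split; first exact: (sep (fun u => oh_lt OH (u i) (u j)) dY fY).
move=> Yw; apply: contrapT => nYv.
apply: (sep (fun u => ~ oh_lt OH (u i) (u j))) nYv Yw; first exact: definable_not.
by move=> v' w' e n' /(fY _ _ (esym e)).
Qed.

Variables (lt' : D -> D -> Prop) (edge' : ('I_n -> D) -> Prop).
Hypothesis lt'M : forall x y z w,
  qf_equiv M (pair_vec x y) (pair_vec z w) -> lt' x y -> lt' z w.
Hypothesis edge'M : forall u v, qf_equiv M u v -> edge' u -> edge' v.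
Hypothesis copy : forall k (u : 'I_k -> D), exists v : 'I_k -> D,
  [/\ qf_equiv M u v,
      forall i j, oh_lt OH (v i) (v j) <-> lt' (u i) (u j)
    & forall w : 'I_n -> 'I_k, oh_edge OH (v \o w) <-> edge' (u \o w)].

(** Each axiom of linear orders involves at most three points; it holds in the copy of these points
    and pulls back along it. Invariance under [OH]-types then leaves only the order and its
    converse. *)
Lemma expansion_lt : (2 <= n)%N ->
  (forall x y, lt' x y <-> oh_lt OH x y) \/ (forall x y, lt' x y <-> oh_lt OH y x).
Proof.
move=> hn; have [irr tra tri _ _] := oh_axioms hOH.
apply: (definable_linear_order hn hOH) => [x|x y z|x y|x y z w e].
- by have [v [_ vl _]] := copy (pair_vec x x); move/(vl ord0 ord0)/irr.
- have [v [_ vl _]] := copy (vsnoc (pair_vec x y) z).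
  have vl' i j : oh_lt OH (v (lift ord_max i)) (v (lift ord_max j)) <->
      lt' (pair_vec x y i) (pair_vec x y j) by rewrite vl !vsnoc_lift.
  have vl2 i : oh_lt OH (v (lift ord_max i)) (v ord_max) <-> lt' (pair_vec x y i) z.
    by rewrite vl vsnoc_lift vsnoc_max.
  by move=> /(vl' ord0 ord_max) xy /(vl2 ord_max) yz; apply/(vl2 ord0)/tra/yz.
- have [v [[eq _ _] vl _]] := copy (pair_vec x y).
  have [/vl|e|/vl] := tri (v ord0) (v ord_max); [by constructor 1| |by constructor 3].
  by constructor 2; apply: ((eq ord0 ord_max).2 e).
- by apply: lt'M; apply: (oh_equiv_qf_equiv hOH).
Qed.

Lemma expansion_edge_injective u : edge' u -> injective u.
Proof.
have [v [[eq _ _] _ ve]] := copy u; have [_ _ _ einj _] := oh_axioms hOH.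
by move=> /(ve id)/einj vI i j /eq/vI.
Qed.

Lemma expansion_edge_perm (s : 'S_n) u : edge' (u \o s) <-> edge' u.
Proof.
have [v [_ _ ve]] := copy u; rewrite -(ve s) -(ve id).
by apply: oh_edge_comp; [exact: oh_axioms hOH | exact: perm_inj].
Qed.

(** [edge'] is symmetric, so both tuples may be sorted; the sorted tuples have the same [OH]-type,
    hence the same [M]-type, which determines [edge']. *)
Lemma expansion_edge u v : injective u -> injective v ->
  (oh_edge OH u <-> oh_edge OH v) -> edge' u -> edge' v.
Proof.
move=> uI vI uv; have ax := oh_axioms hOH.
have [s sP] := oh_equiv_sorted ax uI; have [t tP] := oh_equiv_sorted ax vI.
rewrite -(expansion_edge_perm s u) -(expansion_edge_perm t v).
apply: edge'M; apply: (oh_equiv_qf_equiv hOH MO); apply: oh_equiv_full => //.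
  by move=> i j; rewrite /= sP tP.
by rewrite !oh_edge_comp //; apply: perm_inj.
Qed.

Lemma lt_qf_invariant (u v : 'I_2 -> D) : (2 <= n)%N ->
  qf_equiv M u v -> oh_lt OH (u ord0) (u ord_max) -> oh_lt OH (v ord0) (v ord_max).
Proof.
move=> hn uv; have pairE i j : qf_equiv M (pair_vec (u i) (u j)) (pair_vec (v i) (v j)).
  by rewrite -!comp_pair_vec; apply: qf_equiv_comp.
by have [e|e] := expansion_lt hn; rewrite -!e; apply: lt'M.
Qed.

Lemma reduct_dichotomy : (2 <= n)%N ->
  interdefinable M OH \/ interdefinable M (order_part OH).
Proof.
move=> hn; have [irr tra tri einj esym] := oh_axioms hOH.
have lt_def : definable M (fun v : 'I_2 -> D => @rint _ _ OH LtSym v).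
  apply: definable_qf_invariant => u v uv.
  by rewrite -(pair_vecE u) -(pair_vecE v); apply: lt_qf_invariant.
(* If [M]-types determine the edges, [OH] is definable in [M]. Otherwise an edge and a non-edge
   share an [M]-type, and [M] turns out to depend on the order alone. *)
have [edgeM|no] := pselect (forall u v, qf_equiv M u v -> oh_edge OH u -> oh_edge OH v).
  left; split=> //; split=> [[]|[]//]; first exact: lt_def.
  exact: definable_qf_invariant.
right; split; last by split=> [[]|[]//].
(* [edge'] takes one value on edges and one on injective non-edges. It agrees on the edge [u0] and
   the non-edge [v0], which have the same [M]-type, so the two values coincide. *)
have indep u v : injective u -> injective v -> edge' u -> edge' v.
  move=> uI vI hu; apply: contrapT => hv; apply: no => u0 v0 uv0 e0.
  have u0I := einj _ e0; have [eq _ _] := uv0.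
  have v0I : injective v0 by move=> i j /eq/u0I.
  apply: contrapT => ne0.
  have [eu|neu] := pselect (oh_edge OH u).
    have nev : ~ oh_edge OH v by move=> ev; apply: hv; apply: expansion_edge hu.
    apply: hv; apply: (@expansion_edge v0) => //; apply: edge'M uv0 _.
    by apply: expansion_edge hu.
  have ev : oh_edge OH v.
    by apply: contrapT => nev; apply: hv; apply: expansion_edge hu.
  apply: hv; apply: (@expansion_edge u0) => //; apply: edge'M (qf_equiv_sym uv0) _.
  by apply: expansion_edge hu.
(* The [OH]-type of a copy is read off from [lt'] and [edge'] on the original tuple. As [edge'] is
   constant on injective tuples, order-equivalent tuples have copies of one [OH]-type, and hence one
   [M]-type themselves. *)
have def k (X : ('I_k -> D) -> Prop) :
    (forall u v, qf_equiv M u v -> X u -> X v) -> definable (order_part OH) X.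
  move=> inv; apply: definable_order_invariant => u v uv.
  have eqP_ i j : u i = u j <-> v i = v j.
    split=> e.
      by have [/uv|//|/uv] := tri (v i) (v j); rewrite e => /irr.
    by have [/uv|//|/uv] := tri (u i) (u j); rewrite e => /irr.
  have [u' [uu' ul ue]] := copy u; have [v' [vv' vl ve]] := copy v.
  move=> /(inv _ _ uu') h; apply: (inv _ _ (qf_equiv_sym vv')).
  apply: inv h; apply: (oh_equiv_qf_equiv hOH MO); split=> [i j|w].
    by rewrite ul vl; have [e|e] := expansion_lt hn; rewrite !e uv.
  rewrite ue ve; split=> e; have wI := expansion_edge_injective e.
    by apply: indep e => // i j /eqP_/wI.
  by apply: indep e => // i j /eqP_/wI.
split=> [r|f]; apply: def => u v; [exact: qf_equiv_rint|exact: qf_equiv_graph].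
Qed.

End Reducts.

Theorem theorem3p11 (n : nat) (hn : (2 <= n)%N)
    (D : Type) (OH : structure (oh_lang n) D)
    (hOH : fraisse_limit (@finite_ordered_hypergraph n) OH)
    (L : language) (M : structure L D)
    (hM : fo_reduct M OH)
    (hM_OH : ~ interdefinable M OH)
    (hM_set : ~ interdefinable M (pure_set D))
    (hM_lt : ~ interdefinable M (order_part OH)) :
  ~ ramsey_class (age M).
Proof.
move=> [_ _ _ /(uniform_expansion hOH hM)[lt' [edge' [ltM edgeM copy]]]].
by have [] := reduct_dichotomy hOH hM ltM edgeM copy hn.
Qed.
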